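(* Let $\mathcal C$ be a homological category and let $\mathcal X$ be a (normal epi)-reflective subcategory of $\mathcal C$ such that the reflector $F\colon\mathcal C\to\mathcal X$ admits fiberwise localization. For any object $X$ of $\mathcal C$, write $T(X)$ for the kernel of the reflection $\eta_X\colon X\to F(X)$. Then the following conditions are equivalent: (1) $\mathcal X$ is stable in $\mathcal C$ under extensions; (2) $F(T(X))=0$ for any object $X$ in $\mathcal C$; (3) $F$ is semi-left-exact; (4) $\mathcal X$ is a torsion-free subcategory of $\mathcal C$.
   Context: A category is regular if it is finitely complete, every morphism factors as a regular epimorphism followed by a monomorphism, and regular epimorphisms are stable under pullback. A homological category is a pointed regular category (zero object $0$) in which the Split Short Five Lemma holds: for any morphism $(u,v,w)$ between split epimorphisms (with chosen kernels, and compatible with the splittings), $u\colon K\to K'$ on kernels, $v\colon A\to A'$, $w\colon B\to B'$, if $u$ and $w$ are isomorphisms then so is $v$. A (normal epi)-reflective subcategory $\mathcal X$ of $\mathcal C$ is a full replete reflective subcategory, with inclusion $U$ (often omitted from notation), reflector (left adjoint) $F\colon\mathcal C\to\mathcal X$ and unit $\eta$, such that each $\eta_X\colon X\to UF(X)$ is a normal epimorphism (a cokernel). An extension in $\mathcal C$ is a short exact sequence $0\to K\to E\to Q\to 0$ (the first map is a kernel of the second, the second is a cokernel of the first). The reflector $F$ admits fiberwise localization if for every extension $0\to K\to E\to Q\to 0$ there is an extension $0\to F(K)\to\overline E\to Q\to 0$ and a morphism $e\colon E\to\overline E$ inverted by $F$ (i.e. $F(e)$ is an isomorphism) such that $(\eta_K,e,1_Q)$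 is a morphism of extensions. $\mathcal X$ is stable under extensions in $\mathcal C$ if for any short exact sequence $0\to K\to X\to Y\to 0$ in $\mathcal C$ with $K$ and $Y$ in $\mathcal X$, also $X$ is in $\mathcal X$. $F$ is semi-left-exact if, for every object $X$ of $\mathcal C$ and every morphism $x\colon E\to F(X)$ in $\mathcal X$, $F$ preserves the pullback $X\times_{UF(X)}U(E)$ of $\eta_X\colon X\to UF(X)$ and $U(x)\colon U(E)\to UF(X)$. A torsion theory in $\mathcal C$ is a pair $(\mathcal T,\mathcal F)$ of full replete subcategories of $\mathcal C$ such that the only morphism from an object of $\mathcal T$ to an object of $\mathcal F$ is the zero morphism, and every object $C$ of $\mathcal C$ fits in a short exact sequence $0\to T\to C\to Y\to 0$ with $T$ in $\mathcal T$ and $Y$ in $\mathcal F$. $\mathcal X$ is a torsion-free subcategory of $\mathcal C$ if there is a torsion theory $(\mathcal T,\mathcal X)$ in $\mathcal C$. *)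

(* Defs.v *)
From Stdlib Require Import List FinFun.

Set Implicit Arguments.
Unset Strict Implicit.
Unset Printing Implicit Defensive.

Declare Scope cat_scope.
Delimit Scope cat_scope with cat.

(** * Categories and functors *)

Record category : Type := Category {
  obj :> Type;
  hom : obj -> obj -> Type;
  id : forall A : obj, hom A A;
  comp : forall A B D : obj, hom B D -> hom A B -> hom A D;
  comp_assoc : forall (A B D E : obj) (h : hom D E) (g : hom B D) (f : hom A B),
    comp h (comp g f) = comp (comp h g) f;
  comp_id_l : forall (A B : obj) (f : hom A B), comp (id B) f = f;
  comp_id_r : forall (A B : obj) (f : hom A B), comp f (id A) = f
}.

Arguments id {c} A.

Notation "A ~> B" := (hom A B) (at level 90, right associativity) : cat_scope.
Notation "g \oc f" := (comp g f) (at level 40, left associativity) : cat_scope.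
Open Scope cat_scope.

Record functor (C D : category) : Type := Functor {
  fobj :> C -> D;
  fmap : forall A B : C, (A ~> B) -> (fobj A ~> fobj B);
  fmap_id : forall A : C, fmap (id A) = id (fobj A);
  fmap_comp : forall (A B E : C) (g : B ~> E) (f : A ~> B),
    fmap (g \oc f) = fmap g \oc fmap f
}.

(** * Morphisms, limits and exactness *)

Definition is_iso (C : category) (A B : C) (f : A ~> B) : Prop :=
  exists g : B ~> A, g \oc f = id A /\ f \oc g = id B.

Definition is_mono (C : category) (A B : C) (f : A ~> B) : Prop :=
  forall (X : C) (u v : X ~> A), f \oc u = f \oc v -> u = v.

Definition is_cone (J C : category) (D : functor J C) (L : C)
    (p : forall j : J, L ~> D j) : Prop :=
  forall (i j : J) (a : i ~> j), fmap D a \oc p i = p j.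

Definition is_limit (J C : category) (D : functor J C) (L : C)
    (p : forall j : J, L ~> D j) : Prop :=
  is_cone p /\
  forall (X : C) (q : forall j : J, X ~> D j), is_cone q ->
    exists! h : X ~> L, forall j : J, p j \oc h = q j.

Definition finite_category (J : category) : Prop :=
  Finite J /\ forall i j : J, Finite (i ~> j).

Definition finitely_complete (C : category) : Prop :=
  forall (J : category) (D : functor J C), finite_category J ->
    exists (L : C) (p : forall j : J, L ~> D j), is_limit p.

(** The square with legs [p], [q] over the cospan [f], [g]. *)
Definition is_pullback (C : category) (A B D P : C) (f : A ~> D) (g : B ~> D)
    (p : P ~> A) (q : P ~> B) : Prop :=
  f \oc p = g \oc q /\
  forall (X : C) (u : X ~> A) (v : X ~> B), f \oc u = g \oc v ->
    exists! h : X ~> P, p \oc h = u /\ q \oc h = v.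

Definition is_coequalizer (C : category) (R A B : C) (u v : R ~> A)
    (f : A ~> B) : Prop :=
  f \oc u = f \oc v /\
  forall (X : C) (g : A ~> X), g \oc u = g \oc v -> exists! h : B ~> X, h \oc f = g.

Definition is_regular_epi (C : category) (A B : C) (f : A ~> B) : Prop :=
  exists (R : C) (u v : R ~> A), is_coequalizer u v f.

Definition is_zero_object (C : category) (Z : C) : Prop :=
  forall A : C, (exists! f : Z ~> A, True) /\ (exists! f : A ~> Z, True).

Definition pointed (C : category) : Prop := exists Z : C, is_zero_object Z.

Definition is_zero_morphism (C : category) (A B : C) (f : A ~> B) : Prop :=
  exists (Z : C) (g : Z ~> B) (h : A ~> Z), is_zero_object Z /\ f = g \oc h.

Definition is_kernel (C : category) (K A B : C) (k : K ~> A) (f : A ~> B) : Prop :=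
  is_zero_morphism (f \oc k) /\
  forall (X : C) (g : X ~> A), is_zero_morphism (f \oc g) ->
    exists! h : X ~> K, k \oc h = g.

Definition is_cokernel (C : category) (A B Q : C) (q : B ~> Q) (f : A ~> B) : Prop :=
  is_zero_morphism (q \oc f) /\
  forall (X : C) (g : B ~> X), is_zero_morphism (g \oc f) ->
    exists! h : Q ~> X, h \oc q = g.

Definition is_normal_epi (C : category) (B Q : C) (q : B ~> Q) : Prop :=
  exists (A : C) (f : A ~> B), is_cokernel q f.

Definition is_extension (C : category) (K E Q : C) (k : K ~> E) (f : E ~> Q) : Prop :=
  is_kernel k f /\ is_cokernel f k.

(** * Homological categories *)

Definition regular (C : category) : Prop :=
  finitely_complete C /\
  (forall (A B : C) (f : A ~> B),
     exists (I : C) (e : A ~> I) (m : I ~> B),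
       is_regular_epi e /\ is_mono m /\ f = m \oc e) /\
  (forall (A B D P : C) (f : A ~> D) (g : B ~> D) (p : P ~> A) (q : P ~> B),
     is_pullback f g p q -> is_regular_epi f -> is_regular_epi q).

Definition split_short_five_lemma (C : category) : Prop :=
  forall (K A B K' A' B' : C)
    (k : K ~> A) (f : A ~> B) (s : B ~> A)
    (k' : K' ~> A') (f' : A' ~> B') (s' : B' ~> A')
    (u : K ~> K') (v : A ~> A') (w : B ~> B'),
    f \oc s = id B -> is_kernel k f ->
    f' \oc s' = id B' -> is_kernel k' f' ->
    v \oc k = k' \oc u -> f' \oc v = w \oc f -> v \oc s = s' \oc w ->
    is_iso u -> is_iso w -> is_iso v.

Definition homological (C : category) : Prop :=
  pointed C /\ regular C /\ split_short_five_lemma C.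

(** * Full subcategories and reflections *)

(** A full subcategory of [C] is given by a predicate on the objects of [C]. *)
Definition full_subcategory (C : category) (P : C -> Prop) : category :=
  {| obj := {A : C | P A};
     hom := fun A B => proj1_sig A ~> proj1_sig B;
     id := fun A => id (proj1_sig A);
     comp := fun A B D g f => g \oc f;
     comp_assoc := fun A B D E h g f => comp_assoc h g f;
     comp_id_l := fun A B f => comp_id_l f;
     comp_id_r := fun A B f => comp_id_r f |}.

Definition inclusion (C : category) (P : C -> Prop) :
    functor (full_subcategory P) C :=
  {| fobj := fun A : full_subcategory P => proj1_sig A;
     fmap := fun (A B : full_subcategory P) (f : A ~> B) => f;
     fmap_id := fun A => eq_refl;
     fmap_comp := fun A B D g f => eq_refl |}.

Definition replete (C : category) (P : C -> Prop) : Prop :=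
  forall (A B : C) (f : A ~> B), is_iso f -> P A -> P B.

(** A left adjoint of the inclusion, presented by its unit. *)
Record reflection (C : category) (P : C -> Prop) : Type := Reflection {
  reflector :> functor C (full_subcategory P);
  unit : forall A : C, A ~> inclusion P (reflector A);
  unit_natural : forall (A B : C) (f : A ~> B),
    fmap (inclusion P) (fmap reflector f) \oc unit A = unit B \oc f;
  unit_universal : forall (A : C) (Y : full_subcategory P) (f : A ~> inclusion P Y),
    exists! g : reflector A ~> Y, fmap (inclusion P) g \oc unit A = f
}.

Definition normal_epi_reflective (C : category) (P : C -> Prop)
    (F : reflection P) : Prop :=
  replete P /\ forall A : C, is_normal_epi (unit F A).

Definition admits_fiberwise_localization (C : category) (P : C -> Prop)
    (F : reflection P) : Prop :=
  forall (K E Q : C) (k : K ~> E) (f : E ~> Q), is_extension k f ->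
    exists (E' : C) (k' : inclusion P (F K) ~> E') (f' : E' ~> Q) (e : E ~> E'),
      is_extension k' f' /\ is_iso (fmap F e) /\
      e \oc k = k' \oc unit F K /\ f' \oc e = id Q \oc f.

Definition stable_under_extensions (C : category) (P : C -> Prop) : Prop :=
  forall (K A B : C) (k : K ~> A) (f : A ~> B),
    is_extension k f -> P K -> P B -> P A.

Definition semi_left_exact (C : category) (P : C -> Prop) (F : reflection P) : Prop :=
  forall (A : C) (E : full_subcategory P) (x : E ~> F A)
    (B : C) (p : B ~> A) (q : B ~> inclusion P E),
    is_pullback (unit F A) (fmap (inclusion P) x) p q ->
    is_pullback (fmap F (unit F A)) (fmap F (fmap (inclusion P) x))
                (fmap F p) (fmap F q).

(** * Torsion theories *)

Definition torsion_theory (C : category) (T P : C -> Prop) : Prop :=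
  replete T /\ replete P /\
  (forall (A B : C) (f : A ~> B), T A -> P B -> is_zero_morphism f) /\
  (forall A : C, exists (K Y : C) (k : K ~> A) (f : A ~> Y),
     T K /\ P Y /\ is_extension k f).

Definition torsion_free_subcategory (C : category) (P : C -> Prop) : Prop :=
  exists T : C -> Prop, torsion_theory T P.

(** [F] annihilates the kernel of every unit component; kernels being unique up
    to isomorphism, all of them are considered rather than a chosen one. *)
Definition annihilates_unit_kernels (C : category) (P : C -> Prop)
    (F : reflection P) : Prop :=
  forall (A K : C) (k : K ~> A), is_kernel k (unit F A) ->
    is_zero_object (inclusion P (F K)).

(* Main.v *)
(** Write [T(A)] for the kernel of [unit F A]. Under (1), fiberwise localization
    of [T(A) -> A -> F A] produces an extension [F(T(A)) -> E' -> F A] with [E'] in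
    the subcategory, so that [A -> E'] is again a reflection of [A]; hence
    [E' -> F A] is invertible and its kernel [F(T(A))] vanishes. Conversely, if
    [F(T(A)) = 0] and [A] is an extension of objects of the subcategory, the inclusion
    of [T(A)] in [A] factors through a zero morphism, so [unit F A] is invertible.
    The torsion part of a torsion theory is forced to be [{A | F A = 0}].

    For (2) => (3), let [q : B -> E] be the pullback of [unit F A] along [x] and let
    [r : F B -> E] be the induced morphism. If [r g = 0], pulling [unit F B] back
    along [g] shows that [g], up to a regular epimorphism, factors through
    [T(A) -> B -> F B], which is zero. Protomodularity then makes [r] a monomorphism;
    as [q] is a regular epimorphism, [r] is invertible. *)

From Corelib Require Import ssreflect.
From Stdlib Require Import List FinFun.
Require Import Defs.

Set Implicit Arguments.
Unset Strict Implicit.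
Unset Printing Implicit Defensive.

(** * Zero morphisms and isomorphisms *)

Lemma zero_source_unique (C : category) (Z A : C) (f g : Z ~> A) :
  is_zero_object Z -> f = g.
Proof. by move=> /(_ A) [[h [_ hU]] _]; rewrite -(hU f I) -(hU g I). Qed.

Lemma zero_target_unique (C : category) (Z A : C) (f g : A ~> Z) :
  is_zero_object Z -> f = g.
Proof. by move=> /(_ A) [_ [h [_ hU]]]; rewrite -(hU f I) -(hU g I). Qed.

Lemma zero_morphism_unique (C : category) (A B : C) (f g : A ~> B) :
  is_zero_morphism f -> is_zero_morphism g -> f = g.
Proof.
move=> [Z [f2 [f1 [hZ ->]]]] [Z' [g2 [g1 [hZ' ->]]]].
have [[z _] _] := hZ Z'.
rewrite (zero_source_unique f2 (g2 \oc z) hZ) -comp_assoc.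
by rewrite (zero_target_unique (z \oc f1) g1 hZ').
Qed.

Lemma zero_morphism_compl (C : category) (A B D : C) (g : B ~> D) (f : A ~> B) :
  is_zero_morphism f -> is_zero_morphism (g \oc f).
Proof.
move=> [Z [f2 [f1 [hZ ->]]]]; exists Z, (g \oc f2), f1.
by split; rewrite ?comp_assoc.
Qed.

Lemma zero_morphism_compr (C : category) (A B D : C) (g : B ~> D) (f : A ~> B) :
  is_zero_morphism g -> is_zero_morphism (g \oc f).
Proof.
move=> [Z [g2 [g1 [hZ ->]]]]; exists Z, g2, (g1 \oc f).
by split; rewrite ?comp_assoc.
Qed.

Lemma zero_morphism_exists (C : category) (A B : C) :
  pointed C -> exists f : A ~> B, is_zero_morphism f.
Proof.
move=> [Z hZ]; have [[g _] _] := hZ B; have [_ [h _]] := hZ A.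
by exists (g \oc h), Z, g, h.
Qed.

Lemma zero_object_source (C : category) (Z A : C) (f : Z ~> A) :
  is_zero_object Z -> is_zero_morphism f.
Proof. by move=> hZ; exists Z, f, (id Z); split; rewrite ?comp_id_r. Qed.

Lemma zero_object_of_id (C : category) (A : C) :
  is_zero_morphism (id A) -> is_zero_object A.
Proof.
move=> [Z [g [h [hZ idE]]]] B.
have [[b _] _] := hZ B; have [_ [b' _]] := hZ B.
split.
- exists (b \oc h); split=> // f _.
  rewrite -(comp_id_r f) idE comp_assoc.
  by rewrite (zero_source_unique (f \oc g) b hZ).
- exists (g \oc b'); split=> // f _.
  rewrite -(comp_id_l f) idE -comp_assoc.
  by rewrite (zero_target_unique (h \oc f) b' hZ).
Qed.

Lemma iso_zero_object (C : category) (A B : C) (f : A ~> B) :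
  is_iso f -> is_zero_object A -> is_zero_object B.
Proof.
move=> [g [_ fg]] hA; apply: zero_object_of_id.
by exists A, f, g.
Qed.

Lemma iso_comp (C : category) (A B D : C) (g : B ~> D) (f : A ~> B) :
  is_iso g -> is_iso f -> is_iso (g \oc f).
Proof.
move=> [g' [g'g gg']] [f' [f'f ff']]; exists (f' \oc g'); split.
- by rewrite comp_assoc -(comp_assoc f') g'g comp_id_r.
- by rewrite comp_assoc -(comp_assoc g) ff' comp_id_r.
Qed.

Lemma iso_inv (C : category) (A B : C) (f : A ~> B) (g : B ~> A) :
  is_iso f -> g \oc f = id A -> is_iso g.
Proof.
move=> [h [hf fh]] gf; exists f; split=> //.
have -> : g = h by rewrite -(comp_id_r g) -fh comp_assoc gf comp_id_l.
exact: fh.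
Qed.

Lemma iso_mono (C : category) (A B : C) (f : A ~> B) : is_iso f -> is_mono f.
Proof.
move=> [g [gf _]] Y u v e.
by rewrite -(comp_id_l u) -gf -comp_assoc e comp_assoc gf comp_id_l.
Qed.

Lemma functor_iso (C D : category) (G : functor C D) (A B : C) (f : A ~> B) :
  is_iso f -> is_iso (fmap G f).
Proof.
by move=> [g [gf fg]]; exists (fmap G g); rewrite -!fmap_comp gf fg !fmap_id.
Qed.

(** * Normal and regular epimorphisms *)

Definition is_epi (C : category) (A B : C) (f : A ~> B) : Prop :=
  forall (Y : C) (u v : B ~> Y), u \oc f = v \oc f -> u = v.

Lemma normal_epi_epi (C : category) (A B : C) (f : A ~> B) :
  is_normal_epi f -> is_epi f.
Proof.
move=> [D [d [fd0 fU]]] Y u v e.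
have uf0 : is_zero_morphism ((u \oc f) \oc d).
  by rewrite -comp_assoc; apply: zero_morphism_compl.
have [h [_ hU]] := fU _ _ uf0.
by rewrite -(hU u eq_refl) -(hU v (eq_sym e)).
Qed.

Lemma regular_epi_epi (C : category) (A B : C) (f : A ~> B) :
  is_regular_epi f -> is_epi f.
Proof.
move=> [D [a [b [fab fU]]]] Y u v e.
have ufab : (u \oc f) \oc a = (u \oc f) \oc b by rewrite -!comp_assoc fab.
have [h [_ hU]] := fU _ _ ufab.
by rewrite -(hU u eq_refl) -(hU v (eq_sym e)).
Qed.

Lemma normal_epi_regular_epi (C : category) (A B : C) (f : A ~> B) :
  pointed C -> is_normal_epi f -> is_regular_epi f.
Proof.
move=> pC [D [d [fd0 fU]]]; have [o o0] := zero_morphism_exists D A pC.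
exists D, d, o; split.
  by apply: zero_morphism_unique => //; apply: zero_morphism_compl.
move=> Y g gE; apply: fU; rewrite gE; exact: zero_morphism_compl.
Qed.

Lemma zero_morphism_epi (C : category) (A B D : C) (g : B ~> D) (f : A ~> B) :
  pointed C -> is_epi f -> is_zero_morphism (g \oc f) -> is_zero_morphism g.
Proof.
move=> pC epf gf0; have [o o0] := zero_morphism_exists B D pC.
suff -> : g = o by [].
by apply: epf; apply: zero_morphism_unique => //; apply: zero_morphism_compr.
Qed.

Lemma zero_epi_zero_object (C : category) (A B : C) (f : A ~> B) :
  pointed C -> is_epi f -> is_zero_morphism f -> is_zero_object B.
Proof.
move=> pC epf f0; apply: zero_object_of_id.
by apply: (zero_morphism_epi pC epf); rewrite comp_id_l.
Qed.

(** * Kernels, cokernels and extensions *)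

Lemma kernel_mono (C : category) (K A B : C) (k : K ~> A) (f : A ~> B) :
  is_kernel k f -> is_mono k.
Proof.
move=> [fk0 kU] Y u v e.
have fku0 : is_zero_morphism (f \oc (k \oc u)).
  by rewrite comp_assoc; apply: zero_morphism_compr.
have [h [_ hU]] := kU _ _ fku0.
by rewrite -(hU u eq_refl) -(hU v (eq_sym e)).
Qed.

(** The morphism [d] with cokernel [f] factors through the kernel [k], so whatever kills [k] also
    kills [d] and descends along [f]. *)
Lemma normal_epi_extension (C : category) (K A B : C) (k : K ~> A) (f : A ~> B) :
  is_kernel k f -> is_normal_epi f -> is_extension k f.
Proof.
move=> kf [D [d [fd0 fU]]]; split=> //; split; first by case: kf.
move=> Y g gk0; apply: fU.
have [h [<- _]] := proj2 kf _ _ fd0.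
by rewrite comp_assoc; apply: zero_morphism_compr.
Qed.

Lemma cokernel_zero_iso (C : category) (K A B : C) (k : K ~> A) (f : A ~> B) :
  is_zero_morphism k -> is_cokernel f k -> is_iso f.
Proof.
move=> k0 fk.
have idk0 : is_zero_morphism (id A \oc k) by rewrite comp_id_l.
have [h [hf _]] := proj2 fk _ _ idk0.
exists h; split=> //.
have epf : is_epi f by apply: normal_epi_epi; exists K, k.
by apply: epf; rewrite -comp_assoc hf comp_id_r comp_id_l.
Qed.

Lemma iso_kernel_zero_object (C : category) (K A B : C) (k : K ~> A) (f : A ~> B) :
  is_kernel k f -> is_iso f -> is_zero_object K.
Proof.
move=> kf [g [gf _]]; apply: zero_object_of_id.
have k0 : is_zero_morphism k.
  rewrite -(comp_id_l k) -gf -comp_assoc.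
  by apply: zero_morphism_compl; case: kf.
have [Z [k2 [k1 [hZ kE]]]] := k0.
have [[z _] _] := hZ K.
(* The factorization of the identity through zero is [z \oc k1]; it is checked after composing with
   the mono [k]. *)
exists Z, z, k1; split=> //.
apply: (kernel_mono kf); rewrite comp_id_r comp_assoc kE.
by rewrite (zero_source_unique (k2 \oc k1 \oc z) k2 hZ).
Qed.

(** * Pullbacks *)

(** Finite completeness is stated for functors on finite categories, so pullbacks are obtained from
    an explicit cospan shape. *)
Inductive cospan_shape : Type := Lleg | Rleg | Apex.

(** Homs valued in [True] or [False] make the shape thin, so all category laws reduce to uniqueness
    of arrows. *)
Definition cospan_hom (i j : cospan_shape) : Type :=
  match i, j with
  | Lleg, Lleg | Rleg, Rleg | Apex, Apex | Lleg, Apex | Rleg, Apex => True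
  | _, _ => False
  end.

Definition cospan_id (i : cospan_shape) : cospan_hom i i :=
  match i with Lleg => I | Rleg => I | Apex => I end.

Definition cospan_comp (i j k : cospan_shape) :
  cospan_hom j k -> cospan_hom i j -> cospan_hom i k.
Proof. by case: i; case: j; case: k. Defined.

Lemma cospan_hom_unique (i j : cospan_shape) (a b : cospan_hom i j) : a = b.
Proof. by case: i a b; case: j => //= [] [] []. Qed.

Definition cospan_category : category :=
  {| obj := cospan_shape;
     hom := cospan_hom;
     id := cospan_id;
     comp := cospan_comp;
     comp_assoc := fun _ _ _ _ _ _ _ => cospan_hom_unique _ _;
     comp_id_l := fun _ _ _ => cospan_hom_unique _ _;
     comp_id_r := fun _ _ _ => cospan_hom_unique _ _ |}.

Lemma cospan_finite : finite_category cospan_category.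
Proof.
split; first by exists (Lleg :: Rleg :: Apex :: nil); case=> /=; tauto.
case; case; first [ by exists nil; case | by exists (I :: nil); case; left ].
Qed.

Definition cospan_obj (C : category) (A B D : C) (i : cospan_shape) : C :=
  match i with Lleg => A | Rleg => B | Apex => D end.

Definition cospan_map (C : category) (A B D : C) (f : A ~> D) (g : B ~> D)
    (i j : cospan_shape) :
  cospan_hom i j -> (cospan_obj A B D i ~> cospan_obj A B D j) :=
  match i, j with
  | Lleg, Lleg => fun _ => id A
  | Rleg, Rleg => fun _ => id B
  | Apex, Apex => fun _ => id D
  | Lleg, Apex => fun _ => f
  | Rleg, Apex => fun _ => g
  | _, _ => fun a => False_rect _ a
  end.

Definition cospan (C : category) (A B D : C) (f : A ~> D) (g : B ~> D) :
  functor cospan_category C.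
Proof.
refine (@Functor cospan_category C (cospan_obj A B D) (@cospan_map C A B D f g) _ _).
- by case.
- by case; case; case=> //= [] [] []; rewrite ?comp_id_l ?comp_id_r.
Defined.

Lemma pullback_exists (C : category) (A B D : C) (f : A ~> D) (g : B ~> D) :
  finitely_complete C ->
  exists (P : C) (p : P ~> A) (q : P ~> B), is_pullback f g p q.
Proof.
move=> /(_ _ (cospan f g) cospan_finite) [P [p [pC pU]]].
exists P, (p Lleg), (p Rleg); split.
  by rewrite (pC Lleg Apex I : f \oc _ = _) (pC Rleg Apex I : g \oc _ = _).
move=> Y u v fugv.
pose c (i : cospan_shape) : Y ~> cospan_obj A B D i :=
  match i with Lleg => u | Rleg => v | Apex => f \oc u end.
have cC : is_cone (D := cospan f g) c.
  by case; case=> //= [] []; rewrite ?comp_id_l.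
have [h [hE hU]] := pU _ _ cC.
exists h; split; first by split; [exact: (hE Lleg) | exact: (hE Rleg)].
move=> h' [uE vE]; apply: hU; case=> //=.
by rewrite -(pC Lleg Apex I : f \oc _ = _) -comp_assoc uE.
Qed.

Lemma pullback_jointly_mono (C : category) (A B D P : C) (f : A ~> D) (g : B ~> D)
    (p : P ~> A) (q : P ~> B) (Y : C) (u v : Y ~> P) :
  is_pullback f g p q -> p \oc u = p \oc v -> q \oc u = q \oc v -> u = v.
Proof.
move=> [e pU] pe qe.
have c : f \oc (p \oc u) = g \oc (q \oc u) by rewrite !comp_assoc e.
by have [h [_ hU]] := pU _ _ _ c; rewrite -(hU u) // -(hU v).
Qed.

(** The kernel is the pullback of [f] along the map from a zero object to [B]. *)
Lemma kernel_exists (C : category) (A B : C) (f : A ~> B) :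
  pointed C -> finitely_complete C -> exists (K : C) (k : K ~> A), is_kernel k f.
Proof.
move=> [Z hZ] lC; have [[z _] _] := hZ B.
have [K [k [t kt]]] := pullback_exists f z lC.
exists K, k; split; first by exists Z, z, t; case: kt.
move=> Y g fg0; have [_ [y _]] := hZ Y.
have e : f \oc g = z \oc y by apply: zero_morphism_unique => //; exists Z, z, y.
have [h [[kh _] _]] := proj2 kt _ _ _ e.
exists h; split=> // h' kh'.
apply: (pullback_jointly_mono kt); first by rewrite kh kh'.
exact: zero_target_unique.
Qed.

Lemma iso_square_pullback (C : category) (A B D P : C) (f : A ~> D) (g : B ~> D)
    (p : P ~> A) (q : P ~> B) :
  f \oc p = g \oc q -> is_iso f -> is_iso q -> is_pullback f g p q.
Proof.
move=> e isof isoq; split=> // Y u v fugv.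
have [q' [q'q qq']] := isoq.
have qq'v : q \oc (q' \oc v) = v by rewrite comp_assoc qq' comp_id_l.
exists (q' \oc v); split.
  by split=> //; apply: (iso_mono isof); rewrite comp_assoc e -comp_assoc qq'v.
by move=> h [_ <-]; rewrite comp_assoc q'q comp_id_l.
Qed.

(* The split short five lemma is applied to the diagonal of the kernel pair of [r],
   compared with the identity of [A]: both projections to [A] have zero kernel. *)
Lemma trivial_kernel_mono (C : category) (A B : C) (r : A ~> B) :
  homological C ->
  (forall (Y : C) (g : Y ~> A), is_zero_morphism (r \oc g) -> is_zero_morphism g) ->
  is_mono r.
Proof.
move=> [pC [[lC _] s5]] r0.
have [R [p1 [p2 pR]]] := pullback_exists r r lC.
have [d [[p1d p2d] _]] := proj2 pR _ (id A) (id A) eq_refl.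
(* An invertible diagonal forces [p1 = p2]; any pair identified by [r] factors through the kernel
   pair, hence is equal. *)
suff [d' [_ dd']] : is_iso d.
  have p12 : p1 = p2.
    by rewrite -(comp_id_r p1) -(comp_id_r p2) -dd' !comp_assoc p1d p2d.
  by move=> Y u v /(proj2 pR) [h [[<- <-] _]]; rewrite p12.
have [Z hZ] := pC; have [[a _] _] := hZ A.
have ka : is_kernel a (id A).
  split; first by rewrite comp_id_l; apply: zero_object_source.
  move=> Y g; rewrite comp_id_l => g0; have [_ [y _]] := hZ Y.
  exists y; split; first by apply: zero_morphism_unique => //; exists Z, a, y.
  by move=> y' _; apply: zero_target_unique.
have kda : is_kernel (d \oc a) p1.
  split; first by rewrite comp_assoc p1d; case: ka.
  move=> Y g p1g0; have [_ [y _]] := hZ Y.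
  have day0 : is_zero_morphism (d \oc a \oc y) by exists Z, (d \oc a), y.
  exists y; split; last by move=> y' _; apply: zero_target_unique.
  (* On the kernel pair [r \oc p2 = r \oc p1], so [r \oc (p2 \oc g)] vanishes with [p1 \oc g]. *)
  have p2g0 : is_zero_morphism (p2 \oc g).
    apply: r0; rewrite comp_assoc -(proj1 pR) -comp_assoc.
    exact: zero_morphism_compl.
  by apply: (pullback_jointly_mono pR); apply: zero_morphism_unique => //;
    apply: zero_morphism_compl.
have iid (E : C) : is_iso (id E) by exists (id E); rewrite comp_id_l.
apply: (s5 _ _ _ _ _ _ a (id A) (id A) (d \oc a) p1 d (id Z) d (id A)) => //;
  by rewrite ?comp_id_r ?comp_id_l.
Qed.

(** Since [r] is mono, [e] identifies the pair coequalized by [q]; the induced [h] is a section of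
    the mono [r], hence its inverse. *)
Lemma regular_epi_factor_iso (C : category) (A B D : C) (q : A ~> D) (e : A ~> B)
    (r : B ~> D) :
  is_regular_epi q -> r \oc e = q -> is_mono r -> is_iso r.
Proof.
move=> rq reE mr; have [R [a [b [qab qU]]]] := rq.
have eab : e \oc a = e \oc b by apply: mr; rewrite !comp_assoc reE.
have [h [hq _]] := qU _ _ eab.
have rh : r \oc h = id D.
  by apply: (regular_epi_epi rq); rewrite -comp_assoc hq reE comp_id_l.
exists h; split=> //.
by apply: mr; rewrite comp_assoc rh comp_id_l comp_id_r.
Qed.

(** * Reflections *)

Lemma unit_factor (C : category) (X : C -> Prop) (F : reflection X) (A B : C)
    (f : A ~> B) :
  X B -> exists g : inclusion X (F A) ~> B, g \oc unit F A = f.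
Proof.
move=> XB; have [g [gE _]] := @unit_universal C X F A (exist _ B XB) f.
by exists g.
Qed.

Lemma unit_iso (C : category) (X : C -> Prop) (F : reflection X) (A : C) :
  is_epi (unit F A) -> X A -> is_iso (unit F A).
Proof.
move=> ep XA; have [g gu] := unit_factor F (id A) XA.
exists g; split=> //.
by apply: ep; rewrite -comp_assoc gu comp_id_r comp_id_l.
Qed.

(** Naturality at the unit itself shows that both sides agree after the epi [unit F A]. *)
Lemma fmap_unit (C : category) (X : C -> Prop) (F : reflection X) (A : C) :
  is_epi (unit F A) ->
  fmap (inclusion X) (fmap F (unit F A)) = unit F (inclusion X (F A)).
Proof. by move=> ep; apply: ep; rewrite unit_natural. Qed.

Lemma is_iso_full_subcategory (C : category) (X : C -> Prop)
    (A B : full_subcategory X) (f : A ~> B) :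
  is_iso (fmap (inclusion X) f) -> is_iso f.
Proof. by move=> [g [gf fg]]; exists g. Qed.

(** The unit at [Z] is both zero and epi, so [F Z] is zero and [Z] is isomorphic to it. *)
Lemma zero_object_reflective (C : category) (X : C -> Prop) (F : reflection X)
    (Z : C) :
  pointed C -> normal_epi_reflective F -> is_zero_object Z -> X Z.
Proof.
move=> pC [repX nep] hZ; have epZ := normal_epi_epi (nep Z).
have FZ0 := zero_epi_zero_object pC epZ (zero_object_source (unit F Z) hZ).
have [[z _] _] := FZ0 Z.
apply: (repX _ _ z _ (proj2_sig (F Z))).
by exists (unit F Z); split; apply: zero_source_unique.
Qed.

Lemma zero_to_reflective (C : category) (X : C -> Prop) (F : reflection X)
    (A B : C) (f : A ~> B) :
  is_zero_object (inclusion X (F A)) -> X B -> is_zero_morphism f.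
Proof.
move=> FA0 XB; have [g <-] := unit_factor F f XB.
by exists (inclusion X (F A)), g, (unit F A).
Qed.

(** * Stability under extensions and kernels of units *)

Lemma stable_annihilates (C : category) (X : C -> Prop) (F : reflection X) :
  normal_epi_reflective F -> admits_fiberwise_localization F ->
  stable_under_extensions X -> annihilates_unit_kernels F.
Proof.
move=> [repX nep] fib st A K k kA.
have [E' [k' [f' [e [ext [isoFe [_ fe]]]]]]] :=
  fib _ _ _ _ _ (normal_epi_extension kA (nep A)).
have epi B := normal_epi_epi (nep B).
have XE' : X E' by apply: (st _ _ _ k' f' ext); apply: proj2_sig.
have [i [iu ui]] := unit_iso (epi E') XE'.
(* Composing [Fe] with the inverse [i] of [unit F E'] gives an isomorphism from [F A] to [E'] that
   extends [e] along [unit F A]. *)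
pose Fe := fmap (inclusion X) (fmap F e).
have isom : is_iso (i \oc Fe).
  by apply: iso_comp; [exists (unit F E') | exact: isoFe].
have me : i \oc Fe \oc unit F A = e.
  by rewrite -comp_assoc unit_natural comp_assoc iu comp_id_l.
(* [f'] is invertible as a left inverse of that isomorphism, which is tested on the epi
   [unit F A]. *)
apply: (iso_kernel_zero_object (proj1 ext)); apply: (iso_inv isom).
by apply: (epi A); rewrite -comp_assoc me fe !comp_id_l.
Qed.

Lemma annihilates_stable (C : category) (X : C -> Prop) (F : reflection X) :
  homological C -> normal_epi_reflective F ->
  annihilates_unit_kernels F -> stable_under_extensions X.
Proof.
move=> [pC [[lC _] _]] [repX nep] ann K A B k f ext XK XB.
have [T [t kt]] := kernel_exists (unit F A) pC lC.
have [g gE] := unit_factor F f XB.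
have ft0 : is_zero_morphism (f \oc t).
  by rewrite -gE -comp_assoc; apply: zero_morphism_compl; case: kt.
have [s [sE _]] := proj2 (proj1 ext) _ _ ft0.
(* [s] goes from an object with zero reflection to [K] in the subcategory, so it is zero. *)
have t0 : is_zero_morphism t.
  rewrite -sE; apply: zero_morphism_compl.
  exact: (zero_to_reflective (F := F) _ (ann _ _ _ kt)).
have [h [hu uh]] := cokernel_zero_iso t0 (proj2 (normal_epi_extension kt (nep A))).
by apply: (repX _ _ h _ (proj2_sig (F A))); exists (unit F A).
Qed.

(** * Semi-left-exactness *)

Lemma annihilates_semi_left_exact (C : category) (X : C -> Prop) (F : reflection X) :
  homological C -> normal_epi_reflective F ->
  annihilates_unit_kernels F -> semi_left_exact F.
Proof.
move=> hC [repX nep] ann A E x B p q pb.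
have [pC [[lC [_ pbreg]] _]] := hC.
have epi D := normal_epi_epi (nep D).
have rq : is_regular_epi q.
  by apply: (pbreg _ _ _ _ _ _ _ _ pb); apply: normal_epi_regular_epi.
have [r rE] := unit_factor F q (proj2_sig E).
have isor : is_iso r.
  apply: (regular_epi_factor_iso rq rE); apply: trivial_kernel_mono => // Y g rg0.
  (* [e] is a regular epi, so it suffices that [g \oc e], which equals [unit F B \oc b],
     vanishes. *)
  have [P [b [e pbP]]] := pullback_exists (unit F B) g lC.
  have rege : is_regular_epi e.
    by apply: (pbreg _ _ _ _ _ _ _ _ pbP); apply: normal_epi_regular_epi.
  apply: (zero_morphism_epi pC (regular_epi_epi rege)).
  have qb0 : is_zero_morphism (q \oc b).
    rewrite -rE -comp_assoc (proj1 pbP) comp_assoc.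
    exact: zero_morphism_compr.
  have [T [t kt]] := kernel_exists (unit F A) pC lC.
  have pb0 : is_zero_morphism (unit F A \oc (p \oc b)).
    rewrite comp_assoc (proj1 pb) -comp_assoc.
    exact: zero_morphism_compl.
  have [s [sE _]] := proj2 kt _ _ pb0.
  have [o o0] := zero_morphism_exists T (inclusion X E) pC.
  have c : unit F A \oc t = fmap (inclusion X) x \oc o.
    by apply: zero_morphism_unique; [case: kt | apply: zero_morphism_compl].
  (* [t'] lifts the kernel of [unit F A] to [B] with zero component in [E]; [b] factors through
     it. *)
  have [t' [[pt' qt'] _]] := proj2 pb _ _ _ c.
  have bE : b = t' \oc s.
    apply: (pullback_jointly_mono pb); rewrite comp_assoc ?pt' ?qt' ?sE //.
    by apply: zero_morphism_unique => //; apply: zero_morphism_compr.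
  rewrite -(proj1 pbP) bE comp_assoc; apply: zero_morphism_compr.
  exact: (zero_to_reflective (F := F) _ (ann _ _ _ kt) (proj2_sig (F B))).
(* The image square is a pullback because two parallel sides, [F] of [unit F A] and [F] of [q], are
   invertible. *)
apply: iso_square_pullback.
- by rewrite -!fmap_comp (proj1 pb).
- apply: is_iso_full_subcategory; rewrite fmap_unit //.
  by apply: unit_iso => //; apply: proj2_sig.
- apply: is_iso_full_subcategory.
  have -> : fmap (inclusion X) (fmap F q) = unit F (inclusion X E) \oc r.
    by apply: (epi B); rewrite unit_natural -comp_assoc rE.
  by apply: iso_comp isor; apply: unit_iso => //; apply: proj2_sig.
Qed.

(** The kernel of [unit F A] is its pullback along [0 -> F A]. The image under [F] is the pullback
    of an isomorphism along a map from a zero object, so [F K] is zero. *)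
Lemma semi_left_exact_annihilates (C : category) (X : C -> Prop) (F : reflection X) :
  homological C -> normal_epi_reflective F ->
  semi_left_exact F -> annihilates_unit_kernels F.
Proof.
move=> [pC _] hX sle A K k kA; have [_ nep] := hX.
have epi D := normal_epi_epi (nep D).
have [Z hZ] := pC.
have XZ := zero_object_reflective pC hX hZ.
have [[x _] _] := hZ (inclusion X (F A)); have [_ [q _]] := hZ K.
have pb : is_pullback (unit F A) x k q.
  split; first by apply: zero_morphism_unique; [case: kA | exists Z, x, q].
  move=> Y u v uv.
  have fu0 : is_zero_morphism (unit F A \oc u) by rewrite uv; exists Z, x, v.
  have [h [hE hU]] := proj2 kA _ _ fu0.
  exists h; split; first by split=> //; apply: zero_target_unique.
  by move=> h' [h'E _]; apply: hU.
have [e U] := sle A (exist _ Z XZ) x K k q pb.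
(* [F Z] is a zero object and [F (unit F A)] is invertible, so every endomorphism
   of [F K] is the mediating morphism of the same cone. *)
have FZ0 : is_zero_object (inclusion X (F Z)).
  exact: (iso_zero_object (unit_iso (epi Z) XZ) hZ).
have FuI : is_iso (fmap (inclusion X) (fmap F (unit F A))).
  by rewrite fmap_unit //; apply: unit_iso => //; apply: proj2_sig.
have [o o0] := zero_morphism_exists (inclusion X (F K)) (inclusion X (F K)) pC.
apply: zero_object_of_id.
suff -> : id (inclusion X (F K)) = o by [].
apply: (pullback_jointly_mono (conj e U)).
- apply: (iso_mono FuI).
  (* Commutativity of the image square reroutes both composites through the zero object [F Z]. *)
  rewrite !comp_assoc.
  by move: (e) => /= ->; rewrite -!comp_assoc; congr (_ \oc _);
     apply: (@zero_target_unique C).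
- exact: (@zero_target_unique C).
Qed.

(** * Torsion theories *)

Lemma annihilates_torsion_free (C : category) (X : C -> Prop) (F : reflection X) :
  homological C -> normal_epi_reflective F ->
  annihilates_unit_kernels F -> torsion_free_subcategory X.
Proof.
move=> [pC [[lC _] _]] [repX nep] ann.
exists (fun A => is_zero_object (inclusion X (F A))); split; [|split=> //; split].
- move=> A B f isof; apply: (iso_zero_object (f := fmap (inclusion X) (fmap F f))).
  by do 2 apply: functor_iso.
- by move=> A B f FA0 XB; apply: (zero_to_reflective (F := F)).
- move=> A; have [K [k kA]] := kernel_exists (unit F A) pC lC.
  exists K, (inclusion X (F A)), k, (unit F A); split; first exact: ann kA.
  by split; [exact: proj2_sig | exact: normal_epi_extension].
Qed.

(** The torsion part [S] of [A] and the kernel [K] of its unit factor through each other, so [K] is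
    torsion. The unit at [K] is then both zero and epi, whence [F K] is zero. *)
Lemma torsion_free_annihilates (C : category) (X : C -> Prop) (F : reflection X) :
  pointed C -> normal_epi_reflective F ->
  torsion_free_subcategory X -> annihilates_unit_kernels F.
Proof.
move=> pC [_ nep] [T [repT [_ [TX dec]]]] A K k kA.
have [S [Y [s [f [TS [XY [kf ckf]]]]]]] := dec A.
have [g gE] := unit_factor F f XY.
have us0 : is_zero_morphism (unit F A \oc s).
  by apply: (TX _ _ _ TS); apply: proj2_sig.
have fk0 : is_zero_morphism (f \oc k).
  by rewrite -gE -comp_assoc; apply: zero_morphism_compl; case: kA.
have [a [aE _]] := proj2 kA _ _ us0.
have [b [bE _]] := proj2 kf _ _ fk0.
have TK : T K.
  apply: (repT _ _ a _ TS); exists b; split.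
    by apply: (kernel_mono kf); rewrite comp_assoc bE aE comp_id_r.
  by apply: (kernel_mono kA); rewrite comp_assoc aE bE comp_id_r.
apply: (zero_epi_zero_object pC (normal_epi_epi (nep K))).
exact: (TX _ _ _ TK (proj2_sig (F K))).
Qed.

Theorem proposition6p1 (C : category) (X : C -> Prop) (F : reflection X)
    (hC : homological C)
    (hX : normal_epi_reflective F)
    (hF : admits_fiberwise_localization F) :
  (stable_under_extensions X <-> annihilates_unit_kernels F) /\
  (annihilates_unit_kernels F <-> semi_left_exact F) /\
  (semi_left_exact F <-> torsion_free_subcategory X).
Proof.
(* Each of the other conditions is equivalent to condition (2). *)
have h12 := stable_annihilates hX hF.
have h21 := annihilates_stable hC hX.
have h23 := annihilates_semi_left_exact hC hX.
have h32 := semi_left_exact_annihilates hC hX.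
have h24 := annihilates_torsion_free hC hX.
have h42 := torsion_free_annihilates (proj1 hC) hX.
tauto.
Qed.
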